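(* Let $\Pi=\{n\ge1:\gcd(n,6)=1\}$. For every real $a$, $$\lim_{k\to\infty}\mathbb D_\Pi\left[\,n\in\Pi:\ \frac{\mathfrak o_1(n)+\cdots+\mathfrak o_k(n)-2k}{\sqrt{2k}}<a\,\right]=\frac{1}{\sqrt{2\pi}}\int_{-\infty}^a e^{-u^2/2}\,du .$$
   Context: For an odd integer $n$ let $\mathfrak o(n)=\mathrm{ord}_2(3n+1)$ and $U(n)=(3n+1)/2^{\mathfrak o(n)}$ (accelerated $3x+1$ map). For $n\in\Pi$ and $j\ge 1$ set $\mathfrak o_j(n)=\mathfrak o(U^{(j-1)}(n))$, with $U^{(i)}$ the $i$-th iterate. For $\Sigma\subset\Pi$, $\mathbb D_\Pi(\Sigma)=\lim_{t\to\infty}\frac{3}{t}\#\{n\in\Sigma:n\le t\}$ (the $\Pi$-natural density; for each fixed $k$ the set in the claim has such a density). The numbers $2$ and $2$ appearing are the mean and variance of a geometric random variable with parameter $1/2$. *)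

(* Defs.v *)
From HB Require Import structures.
From mathcomp Require Export all_boot all_order all_algebra.
From mathcomp Require Export finmap.
From mathcomp Require Export all_classical all_reals all_analysis.

Set Implicit Arguments.
Unset Strict Implicit.
Unset Printing Implicit Defensive.

Export Order.TTheory GRing.Theory Num.Theory.
Export numFieldNormedType.Exports.

#[global] Open Scope classical_set_scope.
#[global] Open Scope ring_scope.

Definition Pi : set nat := [set n | (1 <= n)%N /\ coprime n 6].

Definition o (n : nat) : nat := logn 2 (3 * n + 1).

Definition U (n : nat) : nat := ((3 * n + 1) %/ 2 ^ o n)%N.

(* Indexed from j = 1; the value at j = 0 is meaningless and never used. *)
Definition o_ (j n : nat) : nat := o (iter j.-1 U n).

Definition Pi_ratio (R : realType) (S : set nat) (t : R) : R :=
  3 / t * (#|` fset_set [set n : nat | S n /\ n%:R <= t] |)%:R.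

Definition has_Pi_density (R : realType) (S : set nat) : Prop :=
  cvg (Pi_ratio S t @[t --> (+oo : set_system R)]).

(* As usual for [lim], meaningful only when [has_Pi_density R S]. *)
Definition Pi_density (R : realType) (S : set nat) : R :=
  lim (Pi_ratio S t @[t --> (+oo : set_system R)]).

Definition clt_set (R : realType) (k : nat) (a : R) : set nat :=
  [set n | Pi n /\
    ((\sum_(1 <= j < k.+1) o_ j n)%:R - 2 * k%:R) / Num.sqrt (2 * k%:R) < a].

(* Main.v *)
From HB Require Import structures.
Require Import Defs.
From mathcomp Require Import measurable_realfun zify ring lra.

(** Splitting an arithmetic progression of odd difference according to parity,
    and halving after each odd step, shows by induction on [s] that exactly
    [j * 'C(s, k)] of [2 ^ s.+1 * j] consecutive terms undergo [s] halvings in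
    [k.+1] rounds.  Hence within [Pi] the sum [o_1 + ... + o_(k+1)] takes the
    value [s + 1] with density ['C(s, k) / 2 ^ (s + 1)]: it is negative binomial.

    The central limit theorem for this law follows by Stein's method.  The ratio
    of consecutive weights gives the exact identity
    [E ((s + 1) (g (s + 1) - g s) - (s + 1 - 2 (k + 1)) g s) = 0], which bounds
    the variance and, after rescaling, gives [E (f' W - W f W) -> 0] for every
    compactly supported C^1 function [f].  If [u] is continuous with compact
    support and Gaussian mean zero, then [f x = (\int_(-oo)^x u phi) / phi x] is
    such a function and [f' x - x f x = u x], so that [E (u W) -> 0].  Applied to
    [u = c2 g - c1 chi] with [chi] a wide plateau, this and tightness give
    convergence of [E (g W)] to the Gaussian mean of [g], and trapezoids bound
    [P (W < a)] and [P (W >= a)] from below. *)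

Set Implicit Arguments.
Unset Strict Implicit.
Unset Printing Implicit Defensive.

(** * Exponent sums along progressions *)

(* A round starts at an arbitrary [x], odd or even, removes all factors 2 and
   applies [3 * _ + 1]; so [k] rounds from [3 * n + 1] give [o_1 + ... + o_k]. *)
Fixpoint halvings (k x : nat) : nat :=
  if k is k'.+1 then (logn 2 x + halvings k' (3 * (x %/ 2 ^ logn 2 x) + 1))%N
  else 0%N.

Lemma halvings_odd k x : odd x -> halvings k.+1 x = halvings k (3 * x + 1).
Proof.
move=> ox /=; suff -> : logn 2 x = 0%N by rewrite expn0 divn1.
by rewrite lognE dvdn2 ox /= andbF.
Qed.

Lemma halvings_double k x : (0 < x)%N ->
  halvings k.+1 (2 * x) = (halvings k.+1 x).+1.
Proof.
move=> x0 /=; rewrite lognM// [logn 2 2]/= add1n addSn expnS.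
by rewrite divnMl.
Qed.

Lemma halvingsS k x : halvings k.+1 x =
  (logn 2 x + halvings k (3 * (x %/ 2 ^ logn 2 x) + 1))%N.
Proof. by []. Qed.

Arguments halvings : simpl never.

Lemma sum_o_halvings k n :
  (\sum_(1 <= j < k.+1) o_ j n)%N = halvings k (3 * n + 1).
Proof.
elim: k n => [|k IH] n; first by rewrite big_geq.
rewrite big_nat_recl//= halvingsS -IH; congr addn.
rewrite [RHS]big_add1 big_add1/=; apply: eq_bigr => i _.
by rewrite /o_ -iterSr.
Qed.

Lemma big_nat_double (F : nat -> nat) N :
  (\sum_(0 <= m < 2 * N) F m = \sum_(0 <= m < N) F (2 * m)%N +
                               \sum_(0 <= m < N) F (2 * m).+1)%N.
Proof.
elim: N => [|N IH]; first by rewrite muln0 !big_geq.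
rewrite mulnS !addSn add0n !big_nat_recr//= IH; lia.
Qed.

(** Even terms lose a factor 2 within the same round; odd terms close a round and pass to the even
    number [3 * x + 1]. Each parity class is again a progression of odd difference after one
    halving, and the two counts add up by Pascal's rule. *)
Lemma count_halvings s k q r j : odd q -> (0 < r)%N ->
  (\sum_(0 <= m < 2 ^ s.+1 * j) (halvings k.+1 (q * m + r) == s)
   = j * 'C(s, k))%N.
Proof.
elim: s k q r => [|s IH] k q r oq r0.
  (* No halving at all requires [x] odd and a single round, since a second round would start from
     the even number [3 * x + 1]. *)
  have zE x : (0 < x)%N -> (halvings k.+1 x == 0%N) = odd x && (k == 0%N).
    move=> x0; case: (boolP (odd x)) (odd_double_half x) => ox /= xE; last first.
      by rewrite (_ : x = 2 * x./2)%N ?halvings_double//; lia.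
    rewrite halvings_odd//; case: k => [//|k].
    have -> : (3 * x + 1 = 2 * (3 * x./2 + 2))%N by lia.
    by rewrite halvings_double//; lia.
  rewrite expn1 big_nat_double -big_split/= bin0n.
  rewrite (eq_bigr (fun=> nat_of_bool (k == 0%N))); last first.
    move=> m _; rewrite !zE; [|lia|lia].
    rewrite !oddD !oddM/= oq /=; rewrite oddM /=.
    by case: (odd r); case: (k == 0%N).
  by rewrite sum_nat_const_nat subn0.
have even_case c : (0 < c)%N ->
    (\sum_(0 <= m < 2 ^ s.+1 * j)
       (halvings k.+1 (2 * (q * m + c)) == s.+1) = j * 'C(s, k))%N.
  move=> c0; rewrite -(IH k q c)//; apply: eq_bigr => m _.
  by rewrite halvings_double//; lia.
have odd_case c : odd c ->
    (\sum_(0 <= m < 2 ^ s.+1 * j) (halvings k.+1 (2 * (q * m) + c) == s.+1)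
     = j * (if k is k'.+1 then 'C(s, k') else 0))%N.
  move=> oc; case: k {even_case} => [|k].
    rewrite muln0 big1// => m _.
    by rewrite halvings_odd// oddD oddM.
  rewrite -(IH k (3 * q)%N (3 * c./2 + 2)%N); [|by rewrite oddM|lia].
  apply: eq_bigr => m _; rewrite halvings_odd; last by rewrite oddD oddM.
  have -> : (3 * (2 * (q * m) + c) + 1 =
             2 * (3 * q * m + (3 * c./2 + 2)))%N.
    by have := odd_double_half c; rewrite oc; lia.
  by rewrite halvings_double//; lia.
(* Even [m] give the offset [r] and odd [m] the offset [q + r]; as [q] is odd, exactly one of the
   two is even. *)
have rE := odd_double_half r.
rewrite expnS -mulnA big_nat_double.
have -> : (j * 'C(s.+1, k) =
    j * (if k is k'.+1 then 'C(s, k') else 0) + j * 'C(s, k))%N.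
  by rewrite -mulnDr; case: k {even_case odd_case} => [|k]; rewrite ?bin0// binS addnC.
case: (boolP (odd r)) rE => [or|nor] rE.
  rewrite -(odd_case r)// -(even_case (q + r)./2); last by lia.
  congr addn; apply: eq_bigr => m _; congr (nat_of_bool (halvings _ _ == _)); first lia.
  have := odd_double_half (q + r); rewrite oddD oq or /=; lia.
rewrite addnC -(odd_case (q + r)%N); last by rewrite oddD oq (negbTE nor).
rewrite -(even_case r./2); last by lia.
by congr addn; apply: eq_bigr => m _; congr (nat_of_bool (halvings _ _ == _)); lia.
Qed.

Lemma big_nat_coprime6 (P : pred nat) N :
  (\sum_(0 <= n < 6 * N) (coprime n 6 && P n) =
   \sum_(0 <= m < N) P (6 * m + 1) + \sum_(0 <= m < N) P (6 * m + 5))%N.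
Proof.
have cop n : coprime n 6 = (n %% 6 == 1)%N || (n %% 6 == 5)%N.
  rewrite -coprime_modl; have := ltn_pmod n (isT : 0 < 6)%N.
  by move: (n %% 6)%N; do 6 (case=> //).
elim: N => [|N IH]; first by rewrite muln0 !big_geq.
rewrite mulnS !addSn add0n !big_nat_recr//= IH !cop.
set t := (6 * N)%N.
have -> : (t %% 6 = 0)%N by lia.
have -> : (t.+1 %% 6 = 1)%N by lia.
have -> : (t.+2 %% 6 = 2)%N by lia.
have -> : (t.+3 %% 6 = 3)%N by lia.
have -> : (t.+4 %% 6 = 4)%N by lia.
have -> : (t.+4.+1 %% 6 = 5)%N by lia.
rewrite /= addn1 (_ : (t + 5 = t.+4.+1)%N)//; lia.
Qed.

(** For [n] in the classes 1 and 5 modulo 6, [3 * n + 1] is [2 * (9 * m + 2)] or [2 * (9 * m + 8)]: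
    one halving is certain, whence [s.+1] against [s], and two progressions of difference 9 remain,
    whence the factor 2. *)
Lemma count_sum_o s k j :
  (\sum_(0 <= n < 6 * 2 ^ s.+1 * j)
     (coprime n 6 && (\sum_(1 <= i < k.+2) o_ i n == s.+1)) =
   2 * j * 'C(s, k))%N.
Proof.
rewrite -mulnA.
rewrite (big_nat_coprime6 (fun n => \sum_(1 <= i < k.+2) o_ i n == s.+1)%N).
rewrite -mulnA mul2n -addnn.
rewrite -{1}(@count_halvings s k 9 2)// -(@count_halvings s k 9 8)//.
congr addn; apply: eq_bigr => m _; rewrite sum_o_halvings.
  rewrite (_ : 3 * (6 * m + 1) + 1 = 2 * (9 * m + 2))%N; last by lia.
  by rewrite halvings_double//; lia.
rewrite (_ : 3 * (6 * m + 5) + 1 = 2 * (9 * m + 8))%N; last by lia.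
by rewrite halvings_double//; lia.
Qed.

(** * Densities *)

Lemma count_Pi_ratio (R : realType) (P : pred nat) (t : R) : 0 <= t ->
  Pi_ratio [set n | P n] t = 3 / t * (\sum_(0 <= n < (Num.truncn t).+1) P n)%:R.
Proof.
move=> t0; rewrite /Pi_ratio; set N := (Num.truncn t).+1.
have -> : [set n : nat | [set n | P n] n /\ n%:R <= t] =
          [set` [fset n in [seq n <- iota 0 N | P n]]%fset].
  apply/seteqP; split=> n; rewrite /mkset !inE mem_filter mem_iota add0n ltnS.
    by move=> [-> nt] /=; rewrite truncn_ge_nat.
  by case/andP => -> /=; rewrite truncn_ge_nat.
rewrite set_fsetK card_fseq undup_id; last by rewrite filter_uniq ?iota_uniq.
by rewrite size_filter -sum1_count big_mkcond/= /index_iota subn0.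
Qed.

(** By monotonicity the count up to [t] lies between the counts at the neighbouring multiples of
    [q], so the ratio differs from its limit by at most [3 * c / t]. *)
Lemma periodic_Pi_ratio_cvg (R : realType) (P : pred nat) (q c : nat) :
  (0 < q)%N -> (forall j, \sum_(0 <= n < q * j) P n = c * j)%N ->
  Pi_ratio [set n | P n] t @[t --> (+oo : set_system R)] -->
    (3 * c%:R / q%:R : R).
Proof.
move=> q0 Pc.
have q0' : 0 < q%:R :> R by rewrite ltr0n.
pose l : R := 3 * c%:R / q%:R.
have inv0 : (t^-1 : R) @[t --> (+oo : set_system R)] --> (0 : R).
  by apply/gtr0_cvgV0; [exact: nbhs_pinfty_gt|exact: cvg_id].
apply: (@squeeze_cvgr _ _ _ _ (fun t => l - 3 * c%:R / t)
  (fun t => l + 3 * c%:R / t)).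
- near=> t.
  have t0 : 0 < t by near: t; exact: nbhs_pinfty_gt.
  rewrite count_Pi_ratio ?(ltW t0)//.
  set N := (Num.truncn t).+1.
  have mono m n : (m <= n)%N ->
      (\sum_(0 <= i < m) P i <= \sum_(0 <= i < n) P i)%N.
    by move=> mn; rewrite [leqRHS](big_cat_nat (leq0n m) mn)/= leq_addr.
  pose j := Num.truncn (t / q%:R).
  have tq0 : 0 <= t / q%:R by rewrite divr_ge0// ltW.
  have /andP[jt tj] := truncn_itv tq0; rewrite -/j in jt tj.
  have jN : (q * j <= N)%N.
    rewrite /N leqW// truncn_ge_nat ?(ltW t0)// natrM mulrC.
    by rewrite -ler_pdivlMr.
  have Nj : (N <= q * j.+1)%N.
    rewrite /N truncn_lt_nat ?(ltW t0)// natrM mulrC.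
    by rewrite -ltr_pdivrMr.
  have := mono _ _ jN; have := mono _ _ Nj; rewrite !Pc.
  set S := bigop _ _ _ => SU SL.
  have {}SU : S%:R <= c%:R * (t / q%:R + 1).
    apply: (@le_trans _ _ (c * j.+1)%:R); first by rewrite ler_nat.
    by rewrite natrM ler_wpM2l// -natr1 lerD2r.
  have {}SL : c%:R * (t / q%:R - 1) <= S%:R.
    apply: (@le_trans _ _ (c * j)%:R); last by rewrite ler_nat.
    by rewrite natrM ler_wpM2l// lerBlDr natr1 ltW.
  have -> : l - 3 * c%:R / t = 3 / t * (c%:R * (t / q%:R - 1)).
    by rewrite /l; field; rewrite !gt_eqF.
  have -> : l + 3 * c%:R / t = 3 / t * (c%:R * (t / q%:R + 1)).
    by rewrite /l; field; rewrite !gt_eqF.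
  by rewrite !ler_wpM2l// divr_ge0// ltW.
- rewrite -[X in _ --> X]subr0; apply: cvgB; first exact: cvg_cst.
  by rewrite -[X in _ --> X](mulr0 (3 * c%:R)); apply: cvgM => //; exact: cvg_cst.
- rewrite -[X in _ --> X]addr0; apply: cvgD; first exact: cvg_cst.
  by rewrite -[X in _ --> X](mulr0 (3 * c%:R)); apply: cvgM => //; exact: cvg_cst.
Unshelve. all: by end_near. Qed.

(* The weight of the value [s.+1] of the sum of the first [k.+1] exponents. *)
Definition negbin (R : realType) (k s : nat) : R := 'C(s, k)%:R / 2 ^+ s.+1.

Lemma density_sum_o (R : realType) (k T : nat) (A : pred nat) :
  (forall s, A s.+1 -> (s < T)%N) ->
  Pi_ratio [set n | Pi n /\ A (\sum_(1 <= j < k.+2) o_ j n)%N] t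
    @[t --> (+oo : set_system R)] -->
    \sum_(0 <= s < T | A s.+1) negbin R k s.
Proof.
move=> AT.
pose P n := coprime n 6 && A (\sum_(1 <= j < k.+2) o_ j n)%N.
have -> : [set n | Pi n /\ A (\sum_(1 <= j < k.+2) o_ j n)%N] = [set n | P n].
  apply/seteqP; split=> n /=; rewrite /P.
    by move=> [[_ ->] ->].
  by case/andP => n6 ->; split => //; split => //; case: n n6.
(* The count in one block of length [6 * 2 ^ T], which consists of [2 ^ (T - s.+1)] blocks of the
   length [6 * 2 ^ s.+1] belonging to [s]. *)
pose c := (\sum_(0 <= s < T | A s.+1) 2 * 2 ^ (T - s.+1) * 'C(s, k))%N.
have -> : \sum_(0 <= s < T | A s.+1) negbin R k s =
    3 * c%:R / (6 * 2 ^ T)%:R :> R.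
  rewrite /c natr_sum mulr_sumr mulr_suml big_nat_cond [RHS]big_nat_cond.
  apply: eq_bigr => s /andP[/andP[_ sT] _]; rewrite /negbin.
  rewrite -{2}(subnK sT) expnD !natrM !natrX.
  have h n : (2 : R) ^+ n != 0 by rewrite expf_neq0.
  by field; rewrite !h.
apply: periodic_Pi_ratio_cvg; first by rewrite muln_gt0 expn_gt0.
move=> j.
have PE n : nat_of_bool (P n) = (\sum_(0 <= s < T | A s.+1)
    (coprime n 6 && (\sum_(1 <= i < k.+2) o_ i n == s.+1)))%N.
  rewrite /P; have [n6|] /= := boolP (coprime n 6); last by rewrite big1.
  (* As [n] is odd, the first exponent is positive; the sum is thus some [v.+1], and only [s = v]
     can contribute. *)
  have : (0 < \sum_(1 <= i < k.+2) o_ i n)%N.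
    rewrite big_nat_recl//= addn_gt0; apply/orP; left.
    rewrite /o_ /= /o lognE /= dvdn2 oddD oddM addn1 /=.
    by move: n6; rewrite (@coprimeMr n 2 3) coprimen2 => /andP[->].
  case: (\sum_(1 <= i < k.+2) o_ i n)%N (AT) => // v _ _.
  have [Av|nAv] := boolP (A v.+1).
    rewrite big_mkcond (bigD1_seq v)/= ?iota_uniq//; last first.
      by rewrite mem_index_iota AT.
    rewrite Av eqxx big1 ?addn0// => i iv; case: ifP => // _.
    by rewrite eqSS eq_sym (negbTE iv).
  rewrite big1// => i Ai; rewrite eqSS; case: eqP => // vi.
  by rewrite vi Ai in nAv.
under eq_bigr do rewrite PE.
rewrite exchange_big/= /c big_distrl/= big_nat_cond [RHS]big_nat_cond.
apply: eq_bigr => s /andP[/andP[_ sT] _].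
rewrite (_ : 6 * 2 ^ T * j = 6 * 2 ^ s.+1 * (2 ^ (T - s.+1) * j))%N.
  by rewrite count_sum_o; lia.
by rewrite -{1}(subnK sT) expnD; lia.
Qed.

(** * The negative binomial law *)

Section NegativeBinomial.
Variable R : realType.
Implicit Types (k s T : nat) (M : R).

Lemma negbin_ge0 k s : 0 <= negbin R k s.
Proof. by rewrite divr_ge0. Qed.

Lemma negbinS k s : negbin R k.+1 s.+1 = (negbin R k s + negbin R k.+1 s) / 2.
Proof.
by rewrite /negbin binS natrD [in LHS]exprS; field; rewrite expf_neq0.
Qed.

Lemma negbin_ratio k s :
  2 * negbin R k s.+1 * (s.+1%:R - k%:R) = s.+1%:R * negbin R k s.
Proof.
rewrite /negbin [in LHS]exprS.
have bE : 'C(s.+1, k)%:R * (s.+1%:R - k%:R) = s.+1%:R * 'C(s, k)%:R :> R.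
  have [ks|sk] := leqP k s.+1.
    by rewrite -natrB// -!natrM mulnC -(mul_bin_down s.+1 k).
  by rewrite !bin_small ?(ltnW sk)// mulr0n mul0r mulr0.
have e0 : (2 : R) ^+ s.+1 != 0 by rewrite expf_neq0.
apply: (mulfI e0).
rewrite (_ : _ * _ = 'C(s.+1, k)%:R * (s.+1%:R - k%:R)); last by field.
by rewrite bE; field.
Qed.

(** Pascal's rule [negbinS] summed up. The masses for consecutive [k] differ by a boundary term that
    is nonnegative and tends to 0, so both the bound 1 and the limit 1 propagate from [k = 0]. *)
Lemma mass_negbinS k T :
  \sum_(0 <= s < T) negbin R k s =
  \sum_(0 <= s < T) negbin R k.+1 s + 2 * negbin R k.+1 T.
Proof.
elim: T => [|T IH].
  by rewrite !big_geq// /negbin bin0n/= mul0r mulr0 addr0.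
by rewrite !big_nat_recr//= IH negbinS; field.
Qed.

Lemma mass_negbin_le1 k T : \sum_(0 <= s < T) negbin R k s <= 1.
Proof.
elim: k => [|k]; last first.
  by rewrite mass_negbinS; apply: le_trans; rewrite lerDl mulr_ge0 ?negbin_ge0.
suff -> : \sum_(0 <= s < T) negbin R 0 s = 1 - (2 ^+ T)^-1.
  by rewrite lerBlDr lerDl invr_ge0.
elim: T => [|T IH]; first by rewrite big_geq// expr0 invr1 subrr.
by rewrite big_nat_recr//= IH /negbin bin0 exprS; field; rewrite expf_neq0.
Qed.

Lemma negbin_cvg0 k : negbin R k s @[s --> \oo] --> (0 : R).
Proof.
apply: cvg_series_cvg_0; apply: nondecreasing_is_cvgn.
  by apply/nondecreasing_seqP => n; rewrite /series/= big_nat_recr//= lerDl negbin_ge0.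
by exists 1 => _ [n _ <-]; exact: mass_negbin_le1.
Qed.

Lemma mass_negbin_cvg k : \sum_(0 <= s < T) negbin R k s @[T --> \oo] --> (1 : R).
Proof.
elim: k => [|k IH]; last first.
  have -> : (fun T => \sum_(0 <= s < T) negbin R k.+1 s) =
      (fun T => \sum_(0 <= s < T) negbin R k s - 2 * negbin R k.+1 T).
    by apply/funext => T; rewrite (mass_negbinS k) addrK.
  rewrite -[X in _ --> X]subr0; apply: cvgB => //.
  rewrite -[X in _ --> X](mulr0 2); apply: cvgM; first exact: cvg_cst.
  exact: negbin_cvg0.
have -> : (fun T => \sum_(0 <= s < T) negbin R 0 s) =
          (fun T => 1 - 2 * negbin R 0 T).
  apply/funext; elim=> [|T IH]; first by rewrite big_geq// /negbin bin0 expr1; field.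
  by rewrite big_nat_recr//= IH /negbin !bin0 [2 ^+ T.+2]exprS; field; rewrite expf_neq0.
rewrite -[X in _ --> X]subr0; apply: cvgB; first exact: cvg_cst.
rewrite -[X in _ --> X](mulr0 2); apply: cvgM; first exact: cvg_cst.
exact: negbin_cvg0.
Qed.

(* Stein's identity: summation by parts against the ratio recurrence
   [negbin_ratio]; the right-hand side is the boundary term. *)
Lemma negbin_stein k T (g : nat -> R) :
  \sum_(0 <= s < T) negbin R k s *
    (s.+1%:R * (g s.+1 - g s) - (s.+1%:R - 2 * k.+1%:R) * g s) =
  2 * negbin R k T * (T%:R - k%:R) * g T.
Proof.
elim: T => [|T IH].
  rewrite big_geq// /negbin bin0n; case: k => [|k] /=.
    by rewrite subrr !(mulr0, mul0r).
  by rewrite mul0r !(mulr0, mul0r).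
rewrite big_nat_recr//= IH negbin_ratio -!natr1; ring.
Qed.

(** Stein's identity with [g = 1]; the lower bound on [T] makes the boundary term nonnegative, so
    that the truncated mean is bounded by the full one. *)
Lemma negbin_mean k T : (k.+1.*2 <= T)%N ->
  \sum_(0 <= s < T) negbin R k s * s.+1%:R <= 2 * k.+1%:R.
Proof.
move=> kT; have := @negbin_stein k T (fun=> 1).
have : 0 <= 2 * negbin R k T * (T%:R - k%:R) * 1.
  rewrite mulr1 !mulr_ge0 ?negbin_ge0// subr_ge0 ler_nat; lia.
set B := 2 * _ * _ * _ => B0.
rewrite (eq_bigr (fun s => 2 * k.+1%:R * negbin R k s - negbin R k s * s.+1%:R));
  last by move=> s _; ring.
rewrite sumrB -mulr_sumr => h.
have : 2 * k.+1%:R * \sum_(0 <= s < T) negbin R k s <= 2 * k.+1%:R * 1.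
  by rewrite ler_wpM2l ?mulr_ge0// mass_negbin_le1.
by rewrite mulr1; lra.
Qed.

(** Stein's identity with the centred variable as [g], whose increments are 1, bounds the second
    moment by the mean. *)
Lemma negbin_variance k T : (k.+1.*2 <= T)%N ->
  \sum_(0 <= s < T) negbin R k s * (s.+1%:R - 2 * k.+1%:R) ^+ 2 <= 2 * k.+1%:R.
Proof.
move=> kT; apply: (le_trans _ (negbin_mean kT)).
have := @negbin_stein k T (fun s => s.+1%:R - 2 * k.+1%:R).
have : 0 <= 2 * negbin R k T * (T%:R - k%:R) * (T.+1%:R - 2 * k.+1%:R).
  rewrite !mulr_ge0 ?negbin_ge0// subr_ge0 -?natrM ler_nat; lia.
set B := 2 * _ * _ * _ => B0.
rewrite (eq_bigr (fun s => negbin R k s * s.+1%:R -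
    negbin R k s * (s.+1%:R - 2 * k.+1%:R) ^+ 2));
  last by move=> s _; rewrite -!natr1; ring.
by rewrite sumrB; lra.
Qed.

(* Indexed as [negbin]: the sum is [s.+1] and the number of terms [k.+1]. *)
Definition stdz k s : R := (s.+1%:R - 2 * k.+1%:R) / Num.sqrt (2 * k.+1%:R).

Lemma stdz_sqrt_gt0 k : 0 < Num.sqrt (2 * k.+1%:R) :> R.
Proof. by rewrite sqrtr_gt0 mulr_gt0. Qed.

Lemma stdzS k s : stdz k s.+1 = stdz k s + (Num.sqrt (2 * k.+1%:R))^-1.
Proof.
by rewrite /stdz -[s.+2%:R]natr1; field; rewrite gt_eqF// stdz_sqrt_gt0.
Qed.

Lemma negbin_chebyshev k T M : (k.+1.*2 <= T)%N -> 0 < M ->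
  \sum_(0 <= s < T | M <= `|stdz k s|) negbin R k s <= (M ^+ 2)^-1.
Proof.
move=> kT M0; set q := Num.sqrt (2 * k.+1%:R) : R.
have q2 : q ^+ 2 = 2 * k.+1%:R by rewrite sqr_sqrtr// mulr_ge0.
have q0 : 0 < q := stdz_sqrt_gt0 k.
rewrite -[leRHS]mul1r ler_pdivlMr ?exprn_gt0//.
rewrite -(@ler_pM2r _ (2 * k.+1%:R)) ?mulr_gt0// mul1r.
apply: (le_trans _ (negbin_variance kT)).
rewrite -mulrA mulr_suml big_mkcond/=; apply: ler_sum => s _; case: ifPn => [Ms|_].
  rewrite ler_wpM2l ?negbin_ge0//.
  have -> : s.+1%:R - 2 * k.+1%:R = stdz k s * q.
    by rewrite /stdz -/q divfK// gt_eqF.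
  rewrite exprMn q2 ler_wpM2r ?mulr_ge0//.
  by rewrite -[leRHS]real_normK ?num_real// ler_pXn2r// nnegrE ltW.
by rewrite mulr_ge0 ?negbin_ge0 ?sqr_ge0.
Qed.

End NegativeBinomial.

(** * Stein's method *)

(** Heine's theorem on the segment of radius [M + 1]. Since [d < 1], a point closer than [d] to one
    beyond that segment still lies where [f] vanishes. *)
Lemma unif_continuous_compact_support (R : realType) (f : R -> R) (M : R) :
  continuous f -> (forall x, M <= `|x| -> f x = 0) ->
  forall e : R, 0 < e ->
  exists2 d : R, 0 < d & forall x y, `|x - y| < d -> `|f x - f y| < e.
Proof.
move=> cf f0 e e0.
have /compact_near_coveringP cover := @segment_compact R (- (M + 1)) (M + 1).
pose P (d x : R) := forall y, `|x - y| < d -> `|f x - f y| < e.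
have /cover : forall x, [set` `[- (M + 1), M + 1]] x ->
    \forall x' \near x & d \near (0 : R)^'+, P d x'.
  move=> x _.
  have e2 : 0 < e / 2 by rewrite divr_gt0.
  have /cvgrPdist_lt/(_ _ e2)/nbhs_ballP[r /= r0 xr] := cf x.
  exists (ball x (r / 2), [set d | d < r / 2]); first split => /=.
  - by apply: nbhsx_ballx; rewrite divr_gt0.
  - by apply: nbhs_right_lt; rewrite divr_gt0.
  - move=> [z d] /= [xz dr] y zy.
    have fz : `|f x - f z| < e / 2.
      by apply: xr; apply: le_ball xz; rewrite ler_pdivrMr// ler_pMr// ler1n.
    have fy : `|f x - f y| < e / 2.
      apply: xr; rewrite /ball/= (splitr r).
      by rewrite (le_lt_trans (ler_distD z _ _))// ltrD// (lt_trans zy).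
    by rewrite (splitr e) (le_lt_trans (ler_distD (f x) _ _))// ltrD// distrC.
move=> H.
near (0 : R)^'+ => d.
have Hd : `[- (M + 1), M + 1] `<=` P d by near: d; exact: H.
have d0 : 0 < d by [].
have d1 : d < 1 by near: d; exact: nbhs_right_lt.
exists d => // x y xy.
have [xM|xM] := leP `|x| (M + 1).
  by apply: (Hd x) => //=; rewrite in_itv/= -ler_norml.
rewrite f0; last by rewrite ltW// (le_lt_trans _ xM)// lerDl.
rewrite f0 ?subrr ?normr0//.
have : `|x| <= `|x - y| + `|y| by rewrite -{1}(subrK y x) ler_normD.
by lra.
Unshelve. all: by end_near. Qed.

Lemma bounded_compact_support (R : realType) (f : R -> R) (M : R) : 0 <= M ->
  continuous f -> (forall x, M <= `|x| -> f x = 0) ->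
  exists2 C : R, 0 <= C & forall x, `|f x| <= C.
Proof.
move=> M0 cf f0.
have MM : - M <= M by lra.
have cn : {within `[- M, M], continuous (fun x => `|f x|)}.
  apply: continuous_subspaceT => x.
  by apply: (continuous_comp (cf x)); exact: norm_continuous.
have [c _ cmax] := EVT_max MM cn.
exists `|f c| => // x; have [xM|xM] := leP `|x| M.
  by apply: cmax; rewrite in_itv/= -ler_norml.
by rewrite f0 ?normr0// ltW.
Qed.

Section SteinLimit.
Variable R : realType.
Implicit Types (f df g : R -> R) (k T : nat).

(** Truncation at [T] keeps expectations finite sums; in the limits [T] is taken large depending on
    [k]. *)
Definition mean k T g : R := \sum_(0 <= s < T) negbin R k s * g (stdz R k s).

Lemma near_sqrt_small (e : R) : 0 < e ->
  \forall k \near \oo, (Num.sqrt (2 * k.+1%:R))^-1 < e.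
Proof.
move=> e0; near=> k.
have ke : (e ^+ 2)^-1 < k%:R by near: k; exact: nbhs_infty_gtr.
have q0 := stdz_sqrt_gt0 R k.
rewrite -[ltRHS]invrK ltf_pV2 ?posrE ?invr_gt0//.
rewrite -(ger0_norm (ltW (_ : 0 < e^-1))) ?invr_gt0// -sqrtr_sqr ltr_sqrt ?mulr_gt0//.
rewrite exprVn (lt_trans ke)// -natr1; have : 0 <= k%:R :> R by []. lra.
Unshelve. all: by end_near. Qed.

Lemma near_stdz_ge k (M : R) : \forall T \near \oo, M <= stdz R k T.
Proof.
near=> T; rewrite ler_pdivlMr ?stdz_sqrt_gt0//.
have : M * Num.sqrt (2 * k.+1%:R) + 2 * k.+1%:R < T%:R.
  by near: T; exact: nbhs_infty_gtr.
by rewrite -[T.+1%:R]natr1; lra.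
Unshelve. all: by end_near. Qed.

(** With [w] the standardized value and [h] its step, [h ^+ 2 * s.+1 = 1 + w * h]. Stein's identity
    times [h], with increments of [f] rewritten by the mean value theorem, is then a discretization
    of [df w - w * f w]. *)
Lemma mean_stein_cvg0 f df (M : R) : 0 <= M ->
  (forall x : R, is_derive x 1 f (df x)) -> continuous df ->
  (forall x, M <= `|x| -> f x = 0) -> (forall x, M <= `|x| -> df x = 0) ->
  forall e : R, 0 < e -> \forall k \near \oo, \forall T \near \oo,
    `|mean k T (fun x => df x - x * f x)| <= e.
Proof.
move=> M0 ff' cdf f0 df0 e e0.
have [C C0 dfC] := bounded_compact_support M0 cdf df0.
have e2 : 0 < e / 2 by rewrite divr_gt0.
have [d d0 dfd] := unif_continuous_compact_support cdf df0 e2.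
have MC : 0 < (M + 1) * C + 1 by rewrite ltr_wpDl// mulr_ge0// addr_ge0.
near=> k.
set h := (Num.sqrt (2 * k.+1%:R))^-1 : R.
have h0 : 0 < h by rewrite invr_gt0 stdz_sqrt_gt0.
have hd : h < d by rewrite /h; near: k; exact: near_sqrt_small.
have h1 : h < 1 by rewrite /h; near: k; exact: near_sqrt_small.
have hC : (M + 1) * C * h <= e / 2.
  have : h < e / 2 / ((M + 1) * C + 1).
    by rewrite /h; near: k; apply: near_sqrt_small; rewrite divr_gt0.
  by rewrite ltr_pdivlMr// mulrDr mulr1 mulrC; lra.
have hK : h ^+ 2 * (2 * k.+1%:R) = 1.
  by rewrite /h exprVn sqr_sqrtr ?mulr_ge0// mulVf// mulf_neq0.
have WE s : s.+1%:R = 2 * k.+1%:R + stdz R k s / h.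
  by rewrite /stdz -/h mulfK ?gt_eqF//; ring.
near=> T.
(* For large [T] the boundary term of Stein's identity falls outside the support of [f]. *)
have fT : f (stdz R k T) = 0.
  apply: f0; apply: le_trans (ler_norm _).
  by near: T; exact: near_stdz_ge.
have /choice[xi xiP] : forall s, exists x : R,
    stdz R k s <= x <= stdz R k s + h /\
    f (stdz R k s.+1) - f (stdz R k s) = df x * h.
  move=> s; rewrite stdzS -/h; set w := stdz R k s.
  have wh : w <= w + h by rewrite lerDl ltW.
  have [|x xw fx] := @MVT_segment R f df w (w + h) wh (fun x _ => ff' x).
    apply: continuous_subspaceT => x; apply: differentiable_continuous.
    by apply/derivable1_diffP; case: (ff' x).
  by exists x; split; [rewrite in_itv/= in xw|rewrite fx; congr (_ * _); ring].
have := negbin_stein k T (fun s => f (stdz R k s)).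
rewrite fT mulr0 => stein0.
have -> : mean k T (fun x => df x - x * f x) =
    \sum_(0 <= s < T) negbin R k s *
      (df (stdz R k s) - (1 + stdz R k s * h) * df (xi s)).
  (* Subtracting [h] times Stein's identity, whose right-hand side is now 0, cancels the terms
     [w * f w]. *)
  have -> : mean k T (fun x => df x - x * f x) =
      mean k T (fun x => df x - x * f x) - h * 0 by rewrite mulr0 subr0.
  rewrite -[X in h * X]stein0 mulr_sumr -sumrB.
  apply: eq_bigr => s _; have [_ ->] := xiP s.
  rewrite WE; move: hK; move: (2 * k.+1%:R) => K hK.
  set w := stdz R k s.
  transitivity (negbin R k s * (df w - (h ^+ 2 * K + w * h) * df (xi s))).
    by field; rewrite gt_eqF.
  by rewrite hK.
apply: (le_trans (ler_norm_sum _ _ _)).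
apply: (@le_trans _ _ (\sum_(0 <= s < T) negbin R k s * e)); last first.
  by rewrite -mulr_suml ler_piMl ?(ltW e0)// mass_negbin_le1.
apply: ler_sum => s _; rewrite normrM ger0_norm ?negbin_ge0//.
apply: ler_wpM2l; first exact: negbin_ge0.
have [/andP[] + + _] := xiP s; move: (stdz R k s) => w x1 x2.
(* Near the support, uniform continuity controls the shift from [w] to [xi s], and boundedness the
   factor [w * h]. Farther out [h < 1] puts both points where [df] vanishes. *)
have [wM|wM] := leP `|w| (M + 1).
  have -> : df w - (1 + w * h) * df (xi s) =
      (df w - df (xi s)) - w * h * df (xi s) by ring.
  apply: (le_trans (ler_normB _ _)); rewrite [leRHS]splitr lerD//.
    by rewrite ltW// dfd// ltr_norml; lra.
  apply: le_trans hC; rewrite !normrM (gtr0_norm h0) mulrAC.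
  by rewrite ler_wpM2r ?(ltW h0)// ler_pM ?dfC.
have xM : M <= `|xi s|.
  have : `|w| <= `|xi s| + `|xi s - w|.
    by rewrite distrC -{1}(subrKC (xi s) w) ler_normD.
  have : `|xi s - w| <= h by rewrite ler_norml; lra.
  lra.
by rewrite (df0 _ xM) mulr0 subr0 df0 ?normr0 ?(ltW e0)//; lra.
Unshelve. all: by end_near. Qed.

End SteinLimit.

(** * Stein's equation for the standard normal density *)

Section GaussianLimit.
Variable R : realType.
Implicit Types (g u : R -> R) (k T : nat) (x d e M : R).

Local Notation mu := (@lebesgue_measure R).
Local Notation phi := (@normal_pdf R 0 1).

Lemma std_normal_pdfE x :
  phi x = (Num.sqrt (2 * pi))^-1 * expR (- (x ^+ 2) / 2).
Proof.
rewrite normal_pdfE ?oner_neq0// /normal_peak /normal_fun.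
by rewrite !expr1n mul1r subr0 mulr_natl.
Qed.

Lemma std_normal_pdf_gt0 x : 0 < phi x.
Proof.
by rewrite std_normal_pdfE mulr_gt0 ?expR_gt0// invr_gt0 sqrtr_gt0 mulr_gt0 ?pi_gt0.
Qed.

Lemma std_normal_pdf_le1 x : phi x <= 1.
Proof.
rewrite std_normal_pdfE mulr_ile1 ?expR_ge0 ?invr_ge0 ?sqrtr_ge0//.
  rewrite invf_le1; last by rewrite sqrtr_gt0 mulr_gt0 ?pi_gt0.
  rewrite -[leLHS]sqrtr1 ler_wsqrtr//; have := pi_ge2 R; lra.
by rewrite -[leRHS]expR0 ler_expR mulNr oppr_le0 divr_ge0 ?sqr_ge0.
Qed.

Lemma is_derive_std_normal_pdf x : is_derive x 1 phi (- x * phi x).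
Proof.
have -> : phi = (fun x => (Num.sqrt (2 * pi))^-1 * expR (- (x ^+ 2) / 2)).
  by apply/funext => y; exact: std_normal_pdfE.
apply: is_derive_eq.
rewrite /GRing.scale /=; field.
by rewrite gt_eqF// sqrtr_gt0 mulr_gt0 ?pi_gt0.
Qed.

Lemma integrable_bounded_std_normal g : continuous g ->
  (forall x, `|g x| <= 1) ->
  mu.-integrable [set: R] (EFin \o (fun x => g x * phi x)).
Proof.
move=> cg g1.
have mg : measurable_fun [set: R] g by exact: continuous_measurable_fun.
apply: (le_integrable measurableT _ _ (integrable_normal_pdf 0 1)).
  apply/measurable_EFinP; apply: measurable_funM => //.
  exact: measurable_normal_pdf.
move=> x _; rewrite /= lee_fin normrM.
by rewrite ler_piMl.
Qed.

Definition gauss_mean g : R := \int[mu]_x (g x * phi x).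

Lemma mean_cvg0_of_gauss_mean0 u M : 0 <= M -> continuous u ->
  (forall x, `|u x| <= 1) -> (forall x, M <= `|x| -> u x = 0) ->
  gauss_mean u = 0 ->
  forall e, 0 < e -> \forall k \near \oo, \forall T \near \oo,
    `|mean k T u| <= e.
Proof.
move=> M0 cu u1 u0 uint0 e e0.
have iu := integrable_bounded_std_normal cu u1.
pose psi x : R := \int[mu]_(t in `]-oo, x]) (u t * phi t).
have cphi : continuous phi by apply: continuous_normal_pdf; exact: oner_neq0.
have dpsi x : is_derive x 1 psi (u x * phi x).
  have [] := @continuous_FTC1 R (fun t => u t * phi t) -oo%O x (x + 1).
  - by rewrite ltrDl.
  - by apply: integrableS iu.
  - by rewrite ltNyr.
  - by apply: continuousM; [exact: cu|exact: cphi].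
  by move=> dx xE; apply: DeriveDef => //; rewrite -derive1E.
pose f x := psi x / phi x.
have phin0 x : phi x != 0 by rewrite gt_eqF// std_normal_pdf_gt0.
(* To the right of the support [psi x] is the full integral, which is 0 by [uint0]; to the left the
   integrand vanishes. *)
have psi0 x : M <= `|x| -> psi x = 0.
  move=> Mx; have [x0|x0] := leP 0 x.
    rewrite -uint0 /gauss_mean /psi Rintegral_mkcond; apply: eq_Rintegral => t _.
    rewrite patchE; case: ifPn => //; rewrite notin_setE/= in_itv/= => /negP.
    rewrite -ltNge => xt; rewrite u0 ?mul0r//.
    by rewrite (le_trans Mx)// !ger0_norm// ltW// (le_lt_trans x0).
  rewrite /psi (@eq_Rintegral _ _ _ _ _ (fun=> 0)) ?Rintegral_cst ?mul0r//.
  move=> t; rewrite inE/= in_itv/= => tx; rewrite u0 ?mul0r//.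
  by rewrite (le_trans Mx)// !ler0_norm ?lerN2// ltW// (le_lt_trans tx).
(* The quotient rule together with [phi' = - x * phi]: [f] solves Stein's equation for [u]. *)
have ff' x : is_derive x 1 f (u x + x * f x).
  have := is_derive_std_normal_pdf x => dphi.
  rewrite /f; apply: is_derive_eq.
  rewrite /GRing.scale /=; field.
  exact: phin0.
have f0 x : M <= `|x| -> f x = 0 by move=> Mx; rewrite /f psi0// mul0r.
have cf : continuous f.
  move=> x; apply: differentiable_continuous.
  by apply/derivable1_diffP; case: (ff' x).
have -> : u = (fun x => (u x + x * f x) - x * f x).
  by apply/funext => x; rewrite addrK.
apply: (mean_stein_cvg0 M0 ff' _ f0 _ e0).
- move=> x; apply: cvgD; first exact: cu.
  by apply: cvgM; [exact: cvg_id|exact: cf].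
- by move=> x Mx; rewrite u0// f0// mulr0 addr0.
Qed.

(** * Convergence to the Gaussian law *)

Definition gauss_cdf x : R := \int[mu]_(t in `]-oo, x]) phi t.

Lemma integrable_std_normal : mu.-integrable [set: R] (EFin \o phi).
Proof. exact: integrable_normal_pdf. Qed.

Lemma gauss_mean_le1 g : continuous g -> (forall x, 0 <= g x <= 1) ->
  0 <= gauss_mean g <= 1.
Proof.
move=> cg g01.
have g1 x : `|g x| <= 1 by case/andP: (g01 x) => ? ?; rewrite ger0_norm.
apply/andP; split.
  by apply: Rintegral_ge0 => x _; rewrite mulr_ge0 ?normal_pdf_ge0//; case/andP: (g01 x).
have <- : \int[mu]_x phi x = 1 by rewrite /Rintegral integral_normal_pdf.
apply: le_Rintegral => //; first exact: integrable_bounded_std_normal.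
  exact: integrable_std_normal.
move=> x _; rewrite ler_piMl ?normal_pdf_ge0//; by case/andP: (g01 x).
Qed.

Lemma gauss_cdfB x y : x <= y ->
  gauss_cdf y - gauss_cdf x = \int[mu]_(t in `]x, y]) phi t.
Proof.
move=> xy; apply: Rintegral_itvB; rewrite ?bnd_simp//.
exact: (integrableS measurableT _ _ integrable_std_normal).
Qed.

Lemma gauss_cdf_lipschitz x d : 0 <= d ->
  gauss_cdf x <= gauss_cdf (x + d) <= gauss_cdf x + d.
Proof.
move=> d0; have xd : x <= x + d by rewrite lerDl.
rewrite -subr_ge0 -(lerBlDl (gauss_cdf (x + d))) gauss_cdfB//.
rewrite Rintegral_ge0/=; last by move=> t _; exact: normal_pdf_ge0.
have dE : d = \int[mu]_(t in `]x, x + d]) 1.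
  rewrite Rintegral_cst//= mul1r lebesgue_measure_itv/= lte_fin ltrDl.
  by case: ltgtP d0 => //= _ _; ring.
rewrite [leRHS]dE.
apply: le_Rintegral => //.
- exact: (integrableS measurableT _ _ integrable_std_normal).
- apply: (@measurable_bounded_integrable _ _ _ mu (fun=> 1)) => //.
    by rewrite /= lebesgue_measure_itv/=; case: ifP => _; rewrite -?EFinB ltry.
  exact: bounded_cst.
- by move=> t _; exact: std_normal_pdf_le1.
Qed.

Lemma gauss_cdf_cvg :
  gauss_cdf x @[x --> -oo] --> (0 : R) /\ gauss_cdf x @[x --> +oo] --> (1 : R).
Proof.
(* The identity, as a random variable under the normal law, has [gauss_cdf] as its distribution
   function. *)
pose X : {RV (normal_prob 0 1 : probability _ R) >-> R} :=
  HB.pack (idfun : measurableTypeR R -> R)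
    (isMeasurableFun.Build _ _ _ _ (idfun : measurableTypeR R -> R)
       (@measurable_id _ _ setT)).
have -> : gauss_cdf = fine \o cdf X by [].
by split; apply: fine_cvg; [exact: (@cvg_cdfNy0 _ _ _ _ X)|exact: (@cvg_cdfy1 _ _ _ _ X)].
Qed.

Lemma gauss_mean_ge g a b : continuous g -> (forall x, 0 <= g x <= 1) ->
  a <= b -> (forall x, a < x <= b -> g x = 1) ->
  gauss_cdf b - gauss_cdf a <= gauss_mean g.
Proof.
move=> cg g01 ab g1.
have gn x : `|g x| <= 1 by case/andP: (g01 x) => ? ?; rewrite ger0_norm.
rewrite gauss_cdfB// Rintegral_mkcond; apply: le_Rintegral => //.
- rewrite -restrict_EFin; apply/integrable_restrict => //; rewrite setTI.
  exact: (integrableS measurableT _ _ integrable_std_normal).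
- exact: integrable_bounded_std_normal.
move=> x _; rewrite patchE; case: ifPn => [|_].
  by rewrite inE/= in_itv/= => /g1 ->; rewrite mul1r.
by rewrite mulr_ge0 ?normal_pdf_ge0//; case/andP: (g01 x).
Qed.

(** * Trapezoidal test functions *)

(** The clamp of [x] to the unit interval, written with absolute values so that continuity is
    immediate. *)
Definition ramp x : R := (1 + `|x| - `|x - 1|) / 2.

Definition trapezoid a b d x : R := ramp ((x - a) / d) * ramp ((b - x) / d).

Lemma ramp_continuous : continuous ramp.
Proof.
move=> x; apply: cvgM; last exact: cvg_cst.
apply: cvgB; first (apply: cvgD; first exact: cvg_cst).
- exact: norm_continuous.
- apply: cvg_norm; apply: cvgB; [exact: cvg_id|exact: cvg_cst].
Qed.

Lemma ramp01 x : 0 <= ramp x <= 1.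
Proof.
rewrite /ramp; have [] := ger0P x; have [] := ger0P (x - 1); lra.
Qed.

Lemma ramp0 x : x <= 0 -> ramp x = 0.
Proof. rewrite /ramp; have [] := ger0P x; have [] := ger0P (x - 1); lra. Qed.

Lemma ramp1 x : 1 <= x -> ramp x = 1.
Proof. rewrite /ramp; have [] := ger0P x; have [] := ger0P (x - 1); lra. Qed.

Lemma trapezoid_continuous a b d : continuous (trapezoid a b d).
Proof.
move=> x; apply: cvgM.
- apply: (@continuous_comp _ _ _ (fun x => (x - a) / d) ramp);
    last exact: ramp_continuous.
  apply: cvgM; last exact: cvg_cst.
  by apply: cvgB; [exact: cvg_id|exact: cvg_cst].
- apply: (@continuous_comp _ _ _ (fun x => (b - x) / d) ramp);
    last exact: ramp_continuous.
  apply: cvgM; last exact: cvg_cst.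
  by apply: cvgB; [exact: cvg_cst|exact: cvg_id].
Qed.

Lemma trapezoid01 a b d x : 0 <= trapezoid a b d x <= 1.
Proof.
have /andP[? ?] := ramp01 ((x - a) / d); have /andP[? ?] := ramp01 ((b - x) / d).
by rewrite mulr_ge0//= mulr_ile1.
Qed.

Lemma trapezoid0 a b d x : 0 < d -> (x <= a) || (b <= x) ->
  trapezoid a b d x = 0.
Proof.
move=> d0 /orP[xa|bx]; rewrite /trapezoid.
- by rewrite ramp0 ?mul0r// pmulr_lle0 ?invr_gt0// subr_le0.
- by rewrite [X in _ * X]ramp0 ?mulr0// pmulr_lle0 ?invr_gt0// subr_le0.
Qed.

Lemma trapezoid1 a b d x : 0 < d -> a + d <= x <= b - d ->
  trapezoid a b d x = 1.
Proof.
by move=> d0 /andP[ax xb]; rewrite /trapezoid !ramp1 ?mulr1// ler_pdivlMr//; lra.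
Qed.

Lemma gauss_mean_trapezoid_ge a b d : 0 < d -> a + d <= b - d ->
  gauss_cdf b - gauss_cdf a - 2 * d <= gauss_mean (trapezoid a b d).
Proof.
move=> d0 adb.
have := @gauss_mean_ge _ _ _ (@trapezoid_continuous a b d) (@trapezoid01 a b d) adb.
have /andP[_] := gauss_cdf_lipschitz a (ltW d0).
have /andP[_] := gauss_cdf_lipschitz (b - d) (ltW d0).
rewrite subrK => h1 h2 /(_ _)/le_trans h3.
apply: (le_trans _ (h3 _ _ (lexx _))); first by lra.
by move=> x /andP[ax xb]; apply: trapezoid1 => //; rewrite xb ltW.
Qed.

(** * From test functions to distribution functions *)

Lemma mean_ge0 k T g : (forall x, 0 <= g x) -> 0 <= mean k T g.
Proof. by move=> g0; apply: sumr_ge0 => s _; rewrite mulr_ge0 ?negbin_ge0. Qed.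

Lemma mean_le1 k T g : (forall x, g x <= 1) -> mean k T g <= 1.
Proof.
move=> g1; apply: le_trans (mass_negbin_le1 R k T).
by apply: ler_sum => s _; rewrite ler_piMr ?negbin_ge0.
Qed.

(** Tightness: Chebyshev bounds the mass outside the plateau, uniformly in [k], and [e] absorbs the
    mass lost by truncation. *)
Lemma mean_trapezoid_near1 k M e : 0 < M -> 0 < e ->
  \forall T \near \oo,
    1 - e - (M ^+ 2)^-1 <= mean k T (trapezoid (- (M + 1)) (M + 1) 1).
Proof.
move=> M0 e0; near=> T.
have kT : (k.+1.*2 <= T)%N by near: T; exact: nbhs_infty_ge.
have mass : 1 - e <= \sum_(0 <= s < T) negbin R k s.
  near: T; have /cvgrPdist_le/(_ _ e0) := @mass_negbin_cvg R k.
  by apply: filterS => T; rewrite ler_distl => /andP[]; lra.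
apply: (@le_trans _ _ (\sum_(0 <= s < T) negbin R k s -
    \sum_(0 <= s < T | M <= `|stdz R k s|) negbin R k s)).
  by rewrite lerB// negbin_chebyshev.
rewrite [X in _ - X]big_mkcond -sumrB; apply: ler_sum => s _.
case: ifPn => [_|].
  by rewrite subrr mulr_ge0 ?negbin_ge0//; case/andP: (trapezoid01 (- (M + 1)) (M + 1) 1 (stdz R k s)).
rewrite -ltNge ltr_norml => /andP[h1 h2].
rewrite trapezoid1 ?mulr1 ?subr0//; lra.
Unshelve. all: by end_near. Qed.

Lemma mean_cvg_gauss_mean g M : 0 <= M -> continuous g ->
  (forall x, 0 <= g x <= 1) -> (forall x, M <= `|x| -> g x = 0) ->
  forall e, 0 < e -> \forall k \near \oo, \forall T \near \oo,
    `|mean k T g - gauss_mean g| <= e.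
Proof.
move=> M0 cg g01 g0 e e0.
have e8 : 0 < e / 8 by rewrite divr_gt0.
have [cdfNy cdfy] := gauss_cdf_cvg.
have [L [L0 Lcdf Lvar]] : exists L, [/\ 0 < L,
    1 - e / 4 <= gauss_cdf L - gauss_cdf (- L) & (L ^+ 2)^-1 <= e / 8].
  near (+oo : set_system R) => L; exists L; split.
  - by near: L; apply: nbhs_pinfty_gt; rewrite num_real.
  - have h1 : `|1 - gauss_cdf L| <= e / 8.
      by near: L; move/cvgrPdist_le : cdfy; exact.
    have h2 : `|0 - gauss_cdf (- L)| <= e / 8.
      by near: L; move: cdfNy; rewrite cvgNy_compNP => /cvgrPdist_le; exact.
    move: h1 h2; rewrite !ler_norml; lra.
  - have L1 : 1 < L by near: L; apply: nbhs_pinfty_gt; rewrite num_real.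
    have L2 : (e / 8)^-1 < L by near: L; apply: nbhs_pinfty_gt; rewrite num_real.
    have L0 : 0 < L by lra.
    rewrite -[leRHS]invrK lef_pV2 ?posrE ?invr_gt0 ?exprn_gt0//.
    by rewrite (le_trans (ltW L2))// expr2 ler_pMr; lra.
pose chi := trapezoid (- (L + 1)) (L + 1) 1.
have cchi : continuous chi := @trapezoid_continuous _ _ _.
have chi01 : forall x, 0 <= chi x <= 1 := @trapezoid01 _ _ _.
pose c1 := gauss_mean g; pose c2 := gauss_mean chi.
have /andP[c10 c11] : 0 <= c1 <= 1 := gauss_mean_le1 cg g01.
have /andP[c20 c21] : 0 <= c2 <= 1 := gauss_mean_le1 cchi chi01.
have c2L : 1 - e / 4 <= c2.
  apply: (le_trans Lcdf); apply: gauss_mean_ge => //; first by lra.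
  by move=> x ?; apply: trapezoid1 => //; lra.
(* The Gaussian mean of [u] is [c2 * c1 - c1 * c2 = 0], and [u] is a difference of two functions
   with values between 0 and 1. *)
pose u x := c2 * g x - c1 * chi x.
pose N := Num.max M (L + 1).
have N0 : 0 <= N by rewrite le_max M0.
have cu : continuous u.
  move=> x; apply: cvgB; apply: cvgM; try exact: cvg_cst.
    exact: cg.
  exact: cchi.
have u1 x : `|u x| <= 1.
  have /andP[? ?] := g01 x; have /andP[? ?] := chi01 x.
  have ? : 0 <= c2 * g x <= 1 by rewrite mulr_ge0//= mulr_ile1.
  have ? : 0 <= c1 * chi x <= 1 by rewrite mulr_ge0//= mulr_ile1.
  by rewrite ler_norml /u; lra.
have u0 x : N <= `|x| -> u x = 0.
  rewrite ge_max => /andP[Mx Lx]; rewrite /u g0// mulr0 sub0r.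
  rewrite /chi trapezoid0 ?mulr0 ?oppr0//.
  by move: Lx; rewrite ler_normr; lra.
have uint : gauss_mean u = 0.
  rewrite /gauss_mean.
  have gn x : `|g x| <= 1 by case/andP: (g01 x) => ? ?; rewrite ger0_norm.
  have cn x : `|chi x| <= 1 by case/andP: (chi01 x) => ? ?; rewrite ger0_norm.
  under eq_Rintegral => x _.
    have -> : u x * phi x = c2 * (g x * phi x) - c1 * (chi x * phi x).
      by rewrite /u; ring.
    over.
  have i1 := integrable_bounded_std_normal cg gn.
  have i2 := integrable_bounded_std_normal cchi cn.
  rewrite RintegralB//=; 
    [|exact: (integrableZl measurableT c2 i1)|exact: (integrableZl measurableT c1 i2)].
  by rewrite !RintegralZl// -/(gauss_mean g) -/(gauss_mean chi) -/c1 -/c2 mulrC subrr.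
have e4 : 0 < e / 4 by rewrite divr_gt0.
have := mean_cvg0_of_gauss_mean0 N0 cu u1 u0 uint e4.
apply: filterS => k near_u; near=> T.
have muT : `|mean k T u| <= e / 4 by near: T.
have chiT : 1 - e / 8 - (L ^+ 2)^-1 <= mean k T chi.
  by near: T; exact: mean_trapezoid_near1.
(* The outer terms are small because [chi] has mean nearly 1 under both laws, the middle one by
   Stein's method; each is at most [e / 4]. *)
have -> : mean k T g - gauss_mean g =
    (1 - c2) * mean k T g + mean k T u - c1 * (1 - mean k T chi).
  have -> : mean k T u = c2 * mean k T g - c1 * mean k T chi.
    rewrite /mean !mulr_sumr -sumrB; apply: eq_bigr => s _; rewrite /u; ring.
  rewrite -/c1; ring.
have g0T : 0 <= mean k T g by apply: mean_ge0 => x; case/andP: (g01 x).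
have g1T : mean k T g <= 1 by apply: mean_le1 => x; case/andP: (g01 x).
have chi1T : mean k T chi <= 1 by apply: mean_le1 => x; case/andP: (chi01 x).
have ? : 0 <= (1 - c2) * mean k T g <= e / 4.
  rewrite mulr_ge0 ?subr_ge0//=; apply: (@le_trans _ _ (1 - c2)); last by lra.
  by rewrite ler_piMr// subr_ge0.
have ? : 0 <= c1 * (1 - mean k T chi) <= e / 4.
  rewrite mulr_ge0 ?subr_ge0//=; apply: (@le_trans _ _ (1 - mean k T chi)); last by lra.
  by rewrite ler_piMl// subr_ge0.
move: muT; rewrite !ler_norml; lra.
Unshelve. all: by end_near. Qed.

(** A trapezoid on [[b, a]] gives the lower bound. One on [[a, c]] bounds the complementary mass
    from below, hence the sum from above, as the total mass is at most 1. Tails, slopes and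
    convergence cost at most [e / 4] each. *)
Lemma negbin_clt (a e : R) : 0 < e -> \forall k \near \oo, \forall T \near \oo,
  `|\sum_(0 <= s < T | stdz R k s < a) negbin R k s - gauss_cdf a| <= e.
Proof.
move=> e0; have e4 : 0 < e / 4 by rewrite divr_gt0.
have [cdfNy cdfy] := gauss_cdf_cvg.
have [b [c [d [d0 ba ac de [cdfb cdfc]]]]] : exists b c d, [/\ 0 < d,
    b + d <= a - d, a + d <= c - d, 2 * d <= e / 4 &
    gauss_cdf b <= e / 4 /\ 1 - e / 4 <= gauss_cdf c].
  pose d := Num.min 1 (e / 8).
  have d1 : d <= 1 by rewrite ge_min lexx.
  have d8 : d <= e / 8 by rewrite ge_min lexx orbT.
  near (-oo : set_system R) => b; near (+oo : set_system R) => c.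
  exists b, c, d; split.
  - by rewrite lt_min ltr01 divr_gt0.
  - have : b < a - 2 by near: b; apply: nbhs_ninfty_lt; rewrite num_real.
    lra.
  - have : a + 2 < c by near: c; apply: nbhs_pinfty_gt; rewrite num_real.
    lra.
  - lra.
  - split.
    + have : `|0 - gauss_cdf b| <= e / 4.
        by near: b; move/cvgrPdist_le : cdfNy; exact.
      by rewrite ler_norml; lra.
    + have : `|1 - gauss_cdf c| <= e / 4.
        by near: c; move/cvgrPdist_le : cdfy; exact.
      by rewrite ler_norml; lra.
have support (u v x : R) : `|u| + `|v| <= `|x| -> trapezoid u v d x = 0.
  move=> h; apply: trapezoid0 => //; move: h.
  by have [] := ger0P u; have [] := ger0P v; have [] := ger0P x; lra.
have S0 (u v : R) : 0 <= `|u| + `|v| by rewrite addr_ge0.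
have low := mean_cvg_gauss_mean (S0 b a) (@trapezoid_continuous b a d)
  (@trapezoid01 b a d) (support b a) e4.
have upp := mean_cvg_gauss_mean (S0 a c) (@trapezoid_continuous a c d)
  (@trapezoid01 a c d) (support a c) e4.
near=> k; near=> T.
have lowT : `|mean k T (trapezoid b a d) - gauss_mean (trapezoid b a d)| <= e / 4.
  by near: T; near: k.
have uppT : `|mean k T (trapezoid a c d) - gauss_mean (trapezoid a c d)| <= e / 4.
  by near: T; near: k.
have lowg := gauss_mean_trapezoid_ge d0 ba.
have uppg := gauss_mean_trapezoid_ge d0 ac.
have low_le : mean k T (trapezoid b a d) <=
    \sum_(0 <= s < T | stdz R k s < a) negbin R k s.
  rewrite [leRHS]big_mkcond; apply: ler_sum => s _; case: ltP => sa.
    by rewrite ler_piMr ?negbin_ge0//; case/andP: (trapezoid01 b a d (stdz R k s)).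
  by rewrite trapezoid0 ?sa ?orbT// mulr0.
have upp_le : \sum_(0 <= s < T | stdz R k s < a) negbin R k s +
    mean k T (trapezoid a c d) <= 1.
  apply: le_trans (mass_negbin_le1 R k T).
  rewrite big_mkcond -big_split; apply: ler_sum => s _ /=; case: ltP => sa.
    by rewrite trapezoid0 ?(ltW sa)// mulr0 addr0.
  rewrite add0r ler_piMr ?negbin_ge0//.
  by case/andP: (trapezoid01 a c d (stdz R k s)).
move: lowT uppT; rewrite !ler_norml; lra.
Unshelve. all: by end_near. Qed.

End GaussianLimit.

(** * Transfer to densities in [Pi] *)

(** Once [T] exceeds every [s] with standardized value below [a], the truncated sum is the exact
    density. *)
Lemma clt_set_cvg (R : realType) (a : R) k T :
  (forall s, stdz R k s < a -> (s < T)%N) ->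
  Pi_ratio (clt_set k.+1 a) t @[t --> (+oo : set_system R)] -->
    \sum_(0 <= s < T | stdz R k s < a) negbin R k s.
Proof.
move=> aT.
exact: (@density_sum_o R k T (fun n =>
  (n%:R - 2 * k.+1%:R) / Num.sqrt (2 * k.+1%:R) < a) aT).
Qed.

Lemma near_stdz_lt (R : realType) (a : R) k :
  \forall T \near \oo, forall s, stdz R k s < a -> (s < T)%N.
Proof.
near=> T => s; apply: contraTT; rewrite -leqNgt -leNgt => Ts.
apply: (@le_trans _ _ (stdz R k T)); first by near: T; exact: near_stdz_ge.
by rewrite ler_wpM2r ?invr_ge0 ?sqrtr_ge0// lerD2r ler_nat.
Unshelve. all: by end_near. Qed.

Theorem theorem5p4 (R : realType) (a : R) :
  (forall k : nat, (0 < k)%N -> has_Pi_density R (clt_set k a)) /\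
  Pi_density R (clt_set k a) @[k --> \oo] -->
    (Num.sqrt (2 * pi))^-1 *
      \int[lebesgue_measure]_(u in `]-oo, a]) expR (- (u ^+ 2) / 2).
Proof.
split.
  case=> // k _; near \oo => T.
  apply/cvg_ex; eexists; apply: (@clt_set_cvg R a k T).
  by near: T; exact: near_stdz_lt.
have -> : (Num.sqrt (2 * pi))^-1 *
    \int[lebesgue_measure]_(u in `]-oo, a]) expR (- (u ^+ 2) / 2) = gauss_cdf a.
  have q0 : Num.sqrt (2 * pi) != 0 :> R.
    by rewrite gt_eqF// sqrtr_gt0 mulr_gt0 ?pi_gt0.
  under eq_Rintegral => u _.
    have -> : expR (- (u ^+ 2) / 2) = Num.sqrt (2 * pi) * normal_pdf 0 1 u.
      by rewrite std_normal_pdfE mulVKf.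
    over.
  rewrite RintegralZl ?mulKf//.
  exact: (integrableS measurableT _ _ (integrable_std_normal R)).
(* The shift matches the indexing of [negbin], where [k] stands for [k.+1] exponents; [T] is then
   chosen after [k], large enough for [negbin_clt] and for the sum to be exact. *)
rewrite -cvg_shiftS; apply/cvgrPdist_le => e e0.
have := negbin_clt a e0; apply: filterS => k kT /=; near \oo => T.
have -> : Pi_density R (clt_set k.+1 a) =
    \sum_(0 <= s < T | stdz R k s < a) negbin R k s.
  apply: cvg_lim; first exact: Rhausdorff.
  by apply: clt_set_cvg; near: T; exact: near_stdz_lt.
by rewrite distrC; near: T.
Unshelve. all: by end_near. Qed.
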